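(* Let $\mathcal{C}$ be a category with covers, and let $f:N\to M$ be any epimorphism in $\mathcal{C}$. Then $$\mathrm{sec}(f)\leq\sigma_{proj}(M).$$
   Context: Sieves and covers: for a category $\mathcal{C}$ and an object $C$, the overcategory $\mathcal{C}_{|C}$ has as objects the morphisms with codomain $C$. A sieve on $C$ is a full subcategory $S\subset\mathcal{C}_{|C}$ (i.e. a class of morphisms with codomain $C$) such that $f\in S$ implies $f\circ g\in S$ for every $g$ with $\mathrm{codom}(g)=\mathrm{dom}(f)$. The sieve generated by a family $\{f_i:C_i\to C\}_{i\in I}$ consists of all $g:D\to C$ that factor as $D\to C_i\xrightarrow{f_i}C$ for some $i\in I$. A topology on $\mathcal{C}$ assigns to each object $C$ a collection of sieves on $C$, called covering sieves (no axioms are required); a category equipped with a topology is a category with covers. A family $\{f_i:C_i\to C\}_{i\in I}$ is a covering for $C$ if it generates a covering sieve on $C$. For $f:X\to Y$ and $g:Z\to Y$, a $g$-section of $f$ is a morphism $s:Z\to X$ with $f\circ s=g$. $\mathrm{sec}(f)$ is the least integer $m\ge1$ such that there is a covering $\{g_j:Y_j\to Y\}_{j=1}^m$ for $Y$ such that $f$ admits a $g_j$-section for each $j$, and $\infty$ if no such $m$ exists. An object $P$ is projective if for every epimorphism $f:N\to M$ and every morphism $g:P\to M$ there is a morphism $h:P\to N$ with $f\circ h=g$. The projective covering number $\sigma_{proj}(M)$ of an object $M$ is the least integer $m\ge1$ such that there is a covering $\{g_j:P_j\to M\}_{j=1}^m$ for $M$ with each $P_j$ projective, and $\infty$ if no such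 $m$ exists. *)

(* Defs.v *)
From mathcomp Require Import all_boot ssralg ssrnum ssrint.
From mathcomp Require Import boolp classical_sets constructive_ereal.

Set Implicit Arguments.
Unset Strict Implicit.
Unset Printing Implicit Defensive.

Local Open Scope classical_set_scope.
Local Open Scope ereal_scope.

Record category := Category {
  Ob :> Type;
  Mor : Ob -> Ob -> Type;
  mor_id : forall X, Mor X X;
  mor_comp : forall X Y Z, Mor Y Z -> Mor X Y -> Mor X Z;
  comp_idl : forall X Y (f : Mor X Y), mor_comp (mor_id Y) f = f;
  comp_idr : forall X Y (f : Mor X Y), mor_comp f (mor_id X) = f;
  comp_assoc : forall W X Y Z (h : Mor Y Z) (g : Mor X Y) (f : Mor W X),
    mor_comp h (mor_comp g f) = mor_comp (mor_comp h g) f }.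

Declare Scope cat_scope.
Delimit Scope cat_scope with cat.
Notation "f ∘ g" := (@mor_comp _ _ _ _ f g)
  (at level 40, left associativity) : cat_scope.
Local Open Scope cat_scope.

(* A full subcategory of the overcategory is determined by its class of
   objects, i.e. by a class of morphisms with codomain X. *)
Record sieve (C : category) (X : C) := Sieve {
  sieve_mem : forall D : C, set (Mor D X);
  sieve_closed : forall (D E : C) (f : Mor D X) (g : Mor E D),
    sieve_mem f -> sieve_mem (f ∘ g) }.

Definition topology (C : category) := forall X : C, set (sieve X).

Record category_with_covers := CategoryWithCovers {
  cwc_cat :> category;
  covering_sieve : topology cwc_cat }.

Definition generated_mem (C : category) (X : C) (I : Type) (dom : I -> C)
    (f : forall i, Mor (dom i) X) (D : C) : set (Mor D X) :=
  [set g | exists (i : I) (h : Mor D (dom i)), f i ∘ h = g].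

Lemma generated_closed (C : category) (X : C) (I : Type) (dom : I -> C)
    (f : forall i, Mor (dom i) X) (D E : C) (g : Mor D X) (k : Mor E D) :
  generated_mem f g -> generated_mem f (g ∘ k).
Proof. by move=> [i [h <-]]; exists i, (h ∘ k); rewrite comp_assoc. Qed.

Definition generated_sieve (C : category) (X : C) (I : Type) (dom : I -> C)
    (f : forall i, Mor (dom i) X) : sieve X :=
  Sieve (@generated_closed C X I dom f).

Definition is_covering (C : category_with_covers) (X : C) (I : Type)
    (dom : I -> C) (f : forall i, Mor (dom i) X) : Prop :=
  covering_sieve (generated_sieve f).

Definition is_section_along (C : category) (X Y Z : C) (f : Mor X Y)
    (g : Mor Z Y) (s : Mor Z X) : Prop :=
  f ∘ s = g.

Definition epimorphism (C : category) (N M : C) (f : Mor N M) : Prop :=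
  forall (Z : C) (u v : Mor M Z), u ∘ f = v ∘ f -> u = v.

Definition projective (C : category) (P : C) : Prop :=
  forall (N M : C) (f : Mor N M) (g : Mor P M),
    epimorphism f -> exists h : Mor P N, f ∘ h = g.

Definition least_pos (P : nat -> Prop) : \bar int :=
  match pselect (exists m : nat, (1 <= m)%N && `[< P m >]) with
  | left exP => (Posz (ex_minn exP))%:E
  | right _ => +oo
  end.

Definition sec (C : category_with_covers) (X Y : C) (f : Mor X Y) : \bar int :=
  least_pos (fun m => exists (dom : 'I_m -> C) (g : forall j, Mor (dom j) Y),
    is_covering g /\
    forall j, exists s : Mor (dom j) X, is_section_along f (g j) s).

Definition sigma_proj (C : category_with_covers) (M : C) : \bar int :=
  least_pos (fun m => exists (P : 'I_m -> C) (g : forall j, Mor (P j) M),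
    is_covering g /\ forall j, projective (P j)).

(* Main.v *)
Require Import Defs.
From mathcomp Require Import all_boot ssralg ssrnum ssrint.
From mathcomp Require Import boolp classical_sets constructive_ereal.

(** Projectivity lifts each [g j : P j -> M] through the epimorphism [f], and the lift is a
    [g j]-section of [f]. So every covering counted by [sigma_proj M] is counted by [sec f], and
    enlarging a set of integers can only lower its minimum. *)

Lemma least_pos_anti (P Q : nat -> Prop) :
  (forall m, P m -> Q m) -> (least_pos Q <= least_pos P)%E.
Proof.
move=> PQ; rewrite /least_pos.
case: (pselect (exists m, (1 <= m)%N && `[< P m >])) => [exP|_]; last exact: leey.
have sub m : (1 <= m)%N && `[< P m >] -> (1 <= m)%N && `[< Q m >].
  by move=> /andP[-> /asboolP Pm]; apply/asboolP/PQ.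
case: pselect => [exQ|[]]; last by have [m /sub Qm] := exP; exists m.
rewrite lee_fin lez_nat.
(* The least witness [n] of [P] also satisfies [Q], so it bounds the least witness [m] of [Q]. *)
case: ex_minnP => m _ min_m; case: ex_minnP => n /sub Qn _.
exact: min_m.
Qed.

Theorem theorem3p32 (C : category_with_covers) (N M : C) (f : Mor N M)
  (epi_f : epimorphism f) : (sec f <= sigma_proj M)%E.
Proof.
apply: least_pos_anti => m [P [g [cov_g proj_P]]].
by exists P, g; split=> // j; apply: proj_P epi_f.
Qed.
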